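(* (1) $\mathbf{K_N^{Krom,\Box}}\equiv\mathbf{K_N^{Krom}}$; (2) $\mathbf{K_N^{Krom,\Box}}\prec^w\mathbf{K_N^{Krom}}$.
   Context: Fix a finite set $\tau$ of modality labels and a countable set $\mathcal P$ of propositional letters. Formulas of $\mathbf{K_N}$ are generated by $\varphi ::= \top \mid p \mid \neg\varphi \mid \varphi\vee\varphi \mid \Diamond_\alpha\varphi \mid \Box_\alpha\varphi$; $\wedge,\rightarrow$ are abbreviations, $\bot=\neg\top$. Models $M=(\mathcal F,V)$ with frame $\mathcal F=(W,\{R_\alpha\}_{\alpha\in\tau})$, $W\neq\emptyset$, $R_\alpha\subseteq W\times W$, $V:W\to2^{\mathcal P}$, standard Kripke semantics. Positive literals: $\lambda ::= \top \mid p \mid \Diamond_\alpha\lambda \mid \Box_\alpha\lambda$. Clausal form: $\varphi ::= \lambda \mid \neg\lambda \mid \nabla(\neg\lambda_1\vee\dots\vee\neg\lambda_n\vee\lambda_{n+1}\vee\dots\vee\lambda_{n+m}) \mid \varphi\wedge\varphi$, with positive literals $\lambda,\lambda_i$ and $\nabla$ a finite (possibly empty) sequence of boxes. $\mathbf{K_N^{Krom}}$: every clause has $n+m\le2$. $\mathbf{K_N^{Krom,\Box}}$ is the subfragment of $\mathbf{K_N^{Krom}}$ in which positive literals contain no diamonds ($\lambda::=\top\mid p\mid\Box_\alpha\lambda$; prefixes $\nabla$ unchanged). Expressivity (over all Kripke frames). Weak: $\mathbf L\preceq^w\mathbf L'$ if for a fixed alphabet $\mathcal P$ there is an effective translation $\varphi\mapsto\varphi'$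 from $\mathbf L$-formulas to $\mathbf L'$-formulas over the same $\mathcal P$ with $M,w\Vdash\varphi$ iff $M,w\Vdash\varphi'$ for all $M,w$. Strong: for a model $M=(\mathcal F,V)$ over $\mathcal P$ and $\mathcal P'\supseteq\mathcal P$, an extension of $M$ is a model $(\mathcal F,V')$ over $\mathcal P'$ with $V'$ agreeing with $V$ on $\mathcal P$; $\mathbf L\preceq\mathbf L'$ if there is an effective translation taking each $\mathbf L$-formula $\varphi$ over $\mathcal P$ to an $\mathbf L'$-formula $\varphi'$ over some $\mathcal P'\supseteq\mathcal P$ (finitely many new letters) such that for all $M$ over $\mathcal P$ and $w$: $M,w\Vdash\varphi$ iff some extension $M'$ of $M$ has $M',w\Vdash\varphi'$. $\equiv$ (resp. $\equiv^w$) means $\preceq$ (resp. $\preceq^w$) in both directions; $\mathbf L\prec^w\mathbf L'$ means $\mathbf L\preceq^w\mathbf L'$ and not $\mathbf L\equiv^w\mathbf L'$. *)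

(* Defs.v *)
From mathcomp Require Import all_boot.

Set Implicit Arguments.
Unset Strict Implicit.
Unset Printing Implicit Defensive.

Section Syntax.
Variables tau P : Type.

Inductive form :=
| Top
| Var of P
| Neg of form
| Or of form & form
| Dia of tau & form
| Box of tau & form.

Definition Bot := Neg Top.
Definition And a b := Neg (Or (Neg a) (Neg b)).
Definition boxes (nabla : seq tau) (a : form) := foldr Box a nabla.

Fixpoint disj (s : seq form) : form :=
  match s with
  | [::] => Bot
  | [:: a] => a
  | a :: s' => Or a (disj s')
  end.

Fixpoint pos_lit (a : form) : bool :=
  match a with
  | Top | Var _ => true
  | Dia _ b | Box _ b => pos_lit b
  | _ => false
  end.

Fixpoint pos_box_lit (a : form) : bool :=
  match a with
  | Top | Var _ => true
  | Box _ b => pos_box_lit b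
  | _ => false
  end.

(* The empty clause is harmless: [disj [::]] is [Neg Top], which is also the
   one-element clause whose only (negative) literal is [Neg Top]. *)
Inductive krom_over (lit : pred form) : form -> Prop :=
| Krom_pos l : lit l -> krom_over lit l
| Krom_neg l : lit l -> krom_over lit (Neg l)
| Krom_clause nabla (negs poss : seq form) :
    all lit negs -> all lit poss -> size negs + size poss <= 2 ->
    krom_over lit (boxes nabla (disj (map Neg negs ++ poss)))
| Krom_and a b : krom_over lit a -> krom_over lit b -> krom_over lit (And a b).

End Syntax.

Arguments Top {tau P}.
Arguments Var {tau P}.

(* A fragment has to make sense over every alphabet, since strong translations
   enlarge the alphabet. *)
Definition fragment (tau : Type) := forall P : Type, form tau P -> Prop.

Definition Krom (tau : Type) : fragment tau :=
  fun P => krom_over (@pos_lit tau P).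
Definition KromBox (tau : Type) : fragment tau :=
  fun P => krom_over (@pos_box_lit tau P).

Record frame (tau : Type) := Frame {
  world :> Type;
  world_nonempty : inhabited world;
  acc : tau -> world -> world -> Prop
}.

Definition valuation (tau P : Type) (F : frame tau) := F -> P -> Prop.

Fixpoint sat (tau P : Type) (F : frame tau) (V : valuation P F) (w : F)
    (a : form tau P) : Prop :=
  match a with
  | Top => True
  | Var p => V w p
  | Neg b => ~ sat V w b
  | Or b c => sat V w b \/ sat V w c
  | Dia m b => exists v, acc m w v /\ sat V v b
  | Box m b => forall v, acc m w v -> sat V v b
  end.

(* The alphabet P' is [P + 'I_k]: P together with k new letters. *)
Definition extension (tau P : Type) (F : frame tau) (k : nat)
    (V : valuation P F) (V' : valuation (P + 'I_k) F) : Prop :=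
  forall w p, V' w (inl p) <-> V w p.

(* Effectiveness: Kleene's schemes for partial recursive functions, transposed
   from numbers to binary trees (with a while loop as unbounded search), which
   is a Turing-complete model in which syntax is coded without arithmetic.
   A pair is a [Node]; [Leaf] plays the role of false in [PWhile]. *)
Inductive tree := Leaf | Node of tree & tree.

Inductive prog :=
| PId
| PLeaf
| PFst
| PSnd
| PPair of prog & prog
| PComp of prog & prog
| PRec of prog & prog
| PWhile of prog & prog.

(* [eval f x y]: program f halts on input x with output y. *)
Inductive eval : prog -> tree -> tree -> Prop :=
| EId x : eval PId x x
| ELeaf x : eval PLeaf x Leaf
| EFst x y : eval PFst (Node x y) x
| EFstLeaf : eval PFst Leaf Leaf
| ESnd x y : eval PSnd (Node x y) y
| ESndLeaf : eval PSnd Leaf Leaf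
| EPair f g x y z : eval f x y -> eval g x z -> eval (PPair f g) x (Node y z)
| EComp f g x y z : eval g x y -> eval f y z -> eval (PComp f g) x z
| ERecLeaf f g x y : eval f x y -> eval (PRec f g) (Node x Leaf) y
| ERecNode f g x l r yl yr z :
    eval (PRec f g) (Node x l) yl -> eval (PRec f g) (Node x r) yr ->
    eval g (Node x (Node (Node l r) (Node yl yr))) z ->
    eval (PRec f g) (Node x (Node l r)) z
| EWhileStop c f x : eval c x Leaf -> eval (PWhile c f) x x
| EWhileStep c f x u v y z :
    eval c x (Node u v) -> eval f x y -> eval (PWhile c f) y z ->
    eval (PWhile c f) x z.

Definition effective_on (A B : Type) (D : A -> Prop) (codeA : A -> tree)
    (codeB : B -> tree) (f : A -> B) : Prop :=
  exists p : prog, forall a, D a -> eval p (codeA a) (codeB (f a)).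

Definition code_nat (n : nat) : tree := iter n (Node Leaf) Leaf.
Definition code_count (T : countType) (x : T) : tree := code_nat (pickle x).

Fixpoint code_form (tau : countType) (P : Type) (codeP : P -> tree)
    (a : form tau P) : tree :=
  match a with
  | Top => Node (code_nat 0) Leaf
  | Var p => Node (code_nat 1) (codeP p)
  | Neg b => Node (code_nat 2) (code_form codeP b)
  | Or b c => Node (code_nat 3) (Node (code_form codeP b) (code_form codeP c))
  | Dia m b => Node (code_nat 4) (Node (code_count m) (code_form codeP b))
  | Box m b => Node (code_nat 5) (Node (code_count m) (code_form codeP b))
  end.

Definition code_ext_letter (P : countType) (k : nat) (x : P + 'I_k) : tree :=
  match x with
  | inl p => Node (code_nat 0) (code_count p)
  | inr i => Node (code_nat 1) (code_nat i)
  end.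

Definition code_ext_form (tau P : countType)
    (x : {k : nat & form tau (P + 'I_k)}) : tree :=
  Node (code_nat (projT1 x)) (code_form (@code_ext_letter P _) (projT2 x)).

Section Expressivity.
Variables (tau : finType) (P : countType).
Implicit Types L : fragment tau.

Definition weak_le L L' : Prop :=
  exists t : form tau P -> form tau P,
    effective_on (@L P) (code_form (@code_count P)) (code_form (@code_count P)) t
    /\ forall a, L P a ->
         L' P (t a) /\
         forall (F : frame tau) (V : valuation P F) (w : F),
           sat V w a <-> sat V w (t a).

Definition strong_le L L' : Prop :=
  exists t : form tau P -> {k : nat & form tau (P + 'I_k)},
    effective_on (@L P) (code_form (@code_count P)) (@code_ext_form tau P) t
    /\ forall a, L P a ->
         L' _ (projT2 (t a)) /\
         forall (F : frame tau) (V : valuation P F) (w : F),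
           sat V w a <->
           exists V' : valuation (P + 'I_(projT1 (t a))) F,
             extension V V' /\ sat V' w (projT2 (t a)).

Definition weak_equiv L L' : Prop := weak_le L L' /\ weak_le L' L.
Definition strong_equiv L L' : Prop := strong_le L L' /\ strong_le L' L.
Definition weak_lt L L' : Prop := weak_le L L' /\ ~ weak_equiv L L'.

End Expressivity.

(* Main.v *)
Require Import Defs.
From mathcomp Require Import all_boot.
From Stdlib Require Import Classical.

Set Implicit Arguments.
Unset Strict Implicit.
Unset Printing Implicit Defensive.

(** Diamonds can be removed with new letters: for each subformula [c = Dia m b]
    take letters [y] and [z], and force [y <-> ~ b] and [z <-> ~ Box m y] by
    binary clauses, prefixed by the boxes leading to the worlds where they
    matter; then [z] is equivalent to [c] and replaces it.  The letters of [c]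
    are numbered by a Goedel number of [c], so that equal subformulas share
    their letters and no counter has to be threaded through the translation;
    this keeps it primitive recursive on codes.

    Without new letters [Dia m Top] is not expressible: if all letters are true
    everywhere then so are all box literals, hence a [KromBox] formula true at
    a reflexive point stays true at a dead end. *)

(** * Total computable functions on trees *)

Definition computable (f : tree -> tree) : Prop :=
  exists p, forall x, eval p x (f x).

Definition tfst t := if t is Node l _ then l else Leaf.
Definition tsnd t := if t is Node _ r then r else Leaf.
Definition tif c a b := if c is Leaf then a else b : tree.

Fixpoint trec (f g : tree -> tree) (x t : tree) : tree :=
  if t is Node l r then
    g (Node x (Node (Node l r) (Node (trec f g x l) (trec f g x r))))
  else f x.

Lemma computable_id : computable id.
Proof. by exists PId => x; constructor. Qed.

Lemma computable_comp f g :
  computable f -> computable g -> computable (fun x => f (g x)).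
Proof. by move=> [p hp] [q hq]; exists (PComp p q) => x; econstructor. Qed.

Lemma computable_pair f g :
  computable f -> computable g -> computable (fun x => Node (f x) (g x)).
Proof. by move=> [p hp] [q hq]; exists (PPair p q) => x; constructor. Qed.

Lemma computable_const c : computable (fun=> c).
Proof.
elim: c => [|l hl r hr]; last exact: computable_pair.
by exists PLeaf => x; constructor.
Qed.

Lemma computable_fst f : computable f -> computable (fun x => tfst (f x)).
Proof. by apply: computable_comp; exists PFst => -[|l r]; constructor. Qed.

Lemma computable_snd f : computable f -> computable (fun x => tsnd (f x)).
Proof. by apply: computable_comp; exists PSnd => -[|l r]; constructor. Qed.

Lemma computable_trec f g a b :
  computable f -> computable g -> computable a -> computable b ->
  computable (fun x => trec f g (a x) (b x)).
Proof.
move=> [p hp] [q hq] [pa ha] [pb hb].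
exists (PComp (PRec p q) (PPair pa pb)) => x.
apply: EComp (EPair (ha x) (hb x)) _.
elim: (b x) => [|l hl r hr] /=; first exact: ERecLeaf.
exact: ERecNode hl hr (hq _).
Qed.

Lemma computable_tif c a b :
  computable c -> computable a -> computable b ->
  computable (fun x => tif (c x) (a x) (b x)).
Proof.
move=> hc ha hb.
(* Branching is a recursion on the condition that discards the recursive results; the parameter is
   the input itself, which the step recovers with [tfst]. *)
have [||p hp] := @computable_trec a (fun s => b (tfst s)) id c _ _ computable_id hc.
- exact: ha.
- by apply: (computable_comp hb); apply: computable_fst computable_id.
by exists p => x; have := hp x; case: (c x).
Qed.

(** In the argument of the step function of [trec]: the tree recursed upon and
    the results on its two subtrees. *)
Definition cur s := tfst (tsnd s).
Definition recl s := tfst (tsnd (tsnd s)).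
Definition recr s := tsnd (tsnd (tsnd s)).

Ltac computability :=
  repeat first
    [ assumption
    | exact: computable_id
    | exact: computable_const
    | match goal with
      | |- computable (fun x => Node (@?f x) (@?g x)) =>
          apply: (@computable_pair f g)
      | |- computable (fun x => tfst (@?f x)) => apply: (@computable_fst f)
      | |- computable (fun x => tsnd (@?f x)) => apply: (@computable_snd f)
      | |- computable (fun x => tif (@?f x) (@?g x) (@?h x)) =>
          apply: (@computable_tif f g h)
      | |- computable (fun x => trec ?f ?g (@?a x) (@?b x)) =>
          apply: (@computable_trec f g a b)
      | |- computable (fun x => cur (@?f x)) =>
          change (computable (fun x => tfst (tsnd (f x))))
      | |- computable (fun x => recl (@?f x)) =>
          change (computable (fun x => tfst (tsnd (tsnd (f x)))))
      | |- computable (fun x => recr (@?f x)) =>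
          change (computable (fun x => tsnd (tsnd (tsnd (f x)))))
      | |- computable recr =>
          change (computable (fun x => tsnd (tsnd (tsnd x))))
      end ].

(** * Arithmetic and lists as trees *)

(** Numbers are coded as right combs with [Leaf] on every left branch, so recursion on a number
    reads only [recr]. *)
Definition tdouble n :=
  trec (fun=> Leaf) (fun s => Node Leaf (Node Leaf (recr s))) Leaf n.
Definition tshift m n := trec id (fun s => tdouble (recr s)) m n.
Definition tnumber t :=
  trec (fun=> Leaf)
    (fun s => tshift (Node Leaf (tdouble (recr s))) (recl s)) Leaf t.

(** The Goedel numbering: every positive integer is uniquely a power of 2 times an odd number.
    [tnumber] carries it out on trees, so that letter indices are computable. *)
Fixpoint tree_number t : nat :=
  if t is Node l r then 2 ^ tree_number l * (tree_number r).*2.+1 else 0.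

Lemma tdoubleE n : tdouble (code_nat n) = code_nat n.*2.
Proof. by elim: n => //= n <-. Qed.

Lemma tshiftE m n : tshift (code_nat m) (code_nat n) = code_nat (2 ^ n * m).
Proof.
elim: n => [|n ih]; first by rewrite mul1n.
by rewrite {1}/tshift /= -/(tshift _ _) ih /recr /= tdoubleE expnS -mulnA mul2n.
Qed.

Lemma tnumberE t : tnumber t = code_nat (tree_number t).
Proof.
elim: t => //= l ihl r ihr; rewrite -tshiftE -ihl /=.
by rewrite -tdoubleE -ihr.
Qed.

Lemma computable_tdouble f : computable f -> computable (fun x => tdouble (f x)).
Proof. by move=> hf; rewrite /tdouble; computability. Qed.

Lemma computable_tnumber f : computable f -> computable (fun x => tnumber (f x)).
Proof.
move=> hf; rewrite /tnumber /tshift; computability.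
all: by apply: computable_tdouble; computability.
Qed.

Lemma tree_number_ltl l r : tree_number l < tree_number (Node l r).
Proof. by apply: leq_trans (ltn_expl _ (ltnSn 1)) _; rewrite leq_pmulr. Qed.

Lemma tree_number_ltr l r : tree_number r < tree_number (Node l r).
Proof.
rewrite /= (@leq_trans (tree_number r).*2.+1) ?leq_pmull ?expn_gt0 //.
by rewrite ltnS -addnn leq_addr.
Qed.

(** Factors 2 are stripped from both sides together; parity rules out that only one exponent reaches
    0. *)
Lemma pow2_odd_inj a b c d :
  2 ^ a * b.*2.+1 = 2 ^ c * d.*2.+1 -> a = c /\ b = d.
Proof.
elim: a c => [|a ih] [|c].
- by rewrite !mul1n => -[/double_inj].
- move/(congr1 odd); rewrite mul1n expnS -mulnA mul2n /= odd_double.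
  by rewrite odd_double.
- move/(congr1 odd); rewrite mul1n expnS -mulnA mul2n /= odd_double.
  by rewrite odd_double.
- by rewrite !expnS -!mulnA !mul2n => /double_inj/ih[-> ->].
Qed.

Lemma tree_number_inj : injective tree_number.
Proof.
elim=> [|l ihl r ihr] [|l' r'] //.
- by move=> h; have := tree_number_ltl l' r'; rewrite -h.
- by move=> h; have := tree_number_ltl l r; rewrite h.
- by case/pow2_odd_inj => /ihl-> /ihr->.
Qed.

Definition code_list (s : seq tree) : tree := foldr Node Leaf s.
Definition tapp u v :=
  trec id (fun s => Node (tfst (cur s)) (recr s)) v u.
Definition tmap_box m u :=
  trec (fun=> Leaf)
    (fun s => Node (Node (code_nat 5) (Node (tfst s) (tfst (cur s)))) (recr s))
    m u.
(** The tags 2 and 3 spell out [And] as a negated disjunction of negations. *)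
Definition tconj a u :=
  trec id
    (fun s => Node (code_nat 2) (Node (code_nat 3)
       (Node (Node (code_nat 2) (tfst (cur s))) (Node (code_nat 2) (recr s)))))
    a u.

Lemma tappE u v : tapp (code_list u) (code_list v) = code_list (u ++ v).
Proof. by elim: u => //= c u <-. Qed.

Lemma computable_tapp f g :
  computable f -> computable g -> computable (fun x => tapp (f x) (g x)).
Proof. by move=> hf hg; rewrite /tapp; computability. Qed.

Lemma computable_tmap_box f g :
  computable f -> computable g -> computable (fun x => tmap_box (f x) (g x)).
Proof. by move=> hf hg; rewrite /tmap_box; computability. Qed.

Lemma computable_tconj f g :
  computable f -> computable g -> computable (fun x => tconj (f x) (g x)).
Proof. by move=> hf hg; rewrite /tconj; computability. Qed.

Lemma code_nat_inj : injective code_nat.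
Proof. by elim=> [|n ih] [|m] //= [/ih->]. Qed.

Lemma code_count_inj (T : countType) : injective (@code_count T).
Proof. by move=> x y /code_nat_inj/(pcan_inj pickleK). Qed.

Lemma code_form_inj (tau : countType) (P : Type) (codeP : P -> tree) :
  injective codeP -> injective (@code_form tau P codeP).
Proof.
move=> injP; elim=> [|p|b ih|b ihb c ihc|m b ih|m b ih].
- by case.
- by case=> // q [/injP->].
- by case=> // b' [/ih->].
- by case=> // b' c' [/ihb-> /ihc->].
- by case=> // m' b' [/code_count_inj-> /ih->].
- by case=> // m' b' [/code_count_inj-> /ih->].
Qed.

(** * Elimination of diamonds *)

Definition tletter n := Node (code_nat 1) (Node (code_nat 1) n).
Definition tneg a := Node (code_nat 2) a.
Definition tor a b := Node (code_nat 3) (Node a b).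
Definition tbox m a := Node (code_nat 5) (Node m a).

(* The value at a code [c] is the pair of the codes of [undia K c] and
   [dia_defs K c]. *)
Definition tvalue s :=
  let t := cur s in
  let tag := tfst t in
  let r := tsnd t in
  let v := tfst (recr s) in
  let vl := tfst (tfst (tsnd (recr s))) in
  let vr := tfst (tsnd (tsnd (recr s))) in
  let z := tletter (tdouble (tnumber t)) in
  let y := tletter (Node Leaf (tdouble (tnumber t))) in
  let m := tfst r in
  tif tag (Node t Leaf)
 (tif (tsnd tag) (Node (Node (code_nat 1) (Node (code_nat 0) r)) Leaf)
 (tif (tsnd (tsnd tag)) (Node (tneg (tfst v)) (tsnd v))
 (tif (tsnd (tsnd (tsnd tag)))
   (Node (tor (tfst vl) (tfst vr)) (tapp (tsnd vl) (tsnd vr)))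
 (tif (tsnd (tsnd (tsnd (tsnd tag))))
   (Node z (tapp (tmap_box m (tsnd vr))
     (Node (tbox m (tor (tneg y) (tneg (tfst vr))))
     (Node (tbox m (tor y (tfst vr)))
     (Node (tor (tneg z) (tneg (tbox m y)))
     (Node (tor z (tbox m y)) Leaf))))))
   (Node (tbox m (tfst vr)) (tmap_box m (tsnd vr))))))).

(* Subformulas of [c] are not immediate subtrees of its code, so the results on
   the subtrees are kept along with the value. *)
Definition ttable t :=
  trec (fun=> Leaf) (fun s => Node (tvalue s) (Node (recl s) (recr s))) Leaf t.

(** The first component codes the number of new letters: two for each Goedel number up to that of
    the input. *)
Definition ttranslation t :=
  let v := tfst (ttable t) in
  Node (Node Leaf (Node Leaf (tdouble (tnumber t)))) (tconj (tfst v) (tsnd v)).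

(** This equation and the three after it hold by computation; they let later proofs rewrite at one
    connective without unfolding [tvalue]. *)
Lemma ttable_neg c :
  tfst (ttable (Node (code_nat 2) c)) =
  let v := tfst (ttable c) in Node (tneg (tfst v)) (tsnd v).
Proof. by []. Qed.

Lemma ttable_or b c :
  tfst (ttable (Node (code_nat 3) (Node b c))) =
  let vb := tfst (ttable b) in let vc := tfst (ttable c) in
  Node (tor (tfst vb) (tfst vc)) (tapp (tsnd vb) (tsnd vc)).
Proof. by []. Qed.

Lemma ttable_dia m b :
  let c := Node (code_nat 4) (Node m b) in
  let z := tletter (tdouble (tnumber c)) in
  let y := tletter (Node Leaf (tdouble (tnumber c))) in
  let v := tfst (ttable b) in
  tfst (ttable c) =
  Node z (tapp (tmap_box m (tsnd v))
    (code_list [:: tbox m (tor (tneg y) (tneg (tfst v)));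
                   tbox m (tor y (tfst v));
                   tor (tneg z) (tneg (tbox m y));
                   tor z (tbox m y)])).
Proof. by []. Qed.

Lemma ttable_box m b :
  tfst (ttable (Node (code_nat 5) (Node m b))) =
  let v := tfst (ttable b) in Node (tbox m (tfst v)) (tmap_box m (tsnd v)).
Proof. by []. Qed.

Lemma computable_tvalue : computable tvalue.
Proof.
rewrite /tvalue /tletter /tneg /tor /tbox.
by repeat first [ progress computability
  | match goal with
    | |- computable (fun x => tapp (@?f x) (@?g x)) =>
        apply: (@computable_tapp f g)
    | |- computable (fun x => tmap_box (@?f x) (@?g x)) =>
        apply: (@computable_tmap_box f g)
    | |- computable (fun x => tdouble (@?f x)) => apply: (@computable_tdouble f)
    | |- computable (fun x => tnumber (@?f x)) => apply: (@computable_tnumber f)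
    end ].
Qed.

Lemma computable_ttranslation : computable ttranslation.
Proof.
have htable : computable ttable.
  rewrite /ttable; computability; exact: computable_tvalue.
rewrite /ttranslation; computability.
- by apply: computable_tdouble; apply: computable_tnumber; exact: computable_id.
- by apply: computable_tconj; computability.
Qed.

(** * The translation on formulas and its agreement with the program *)

Section Translation.
Variables tau P : countType.
Implicit Types (a b c : form tau P) (K : nat).

Let code := code_form (tau := tau) (@code_count P).

Definition form_number c := tree_number (code c).

(* [inord] sends indices above [K] to [0]; [K] is chosen so large that this does
   not happen. *)
Definition dia_letter K c : form tau (P + 'I_K.+1) :=
  Var (inr (inord (form_number c).*2)).
Definition arg_letter K c : form tau (P + 'I_K.+1) :=
  Var (inr (inord (form_number c).*2.+1)).

Fixpoint undia K a : form tau (P + 'I_K.+1) :=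
  match a with
  | Top => Top
  | Var p => Var (inl p)
  | Neg b => Neg (undia K b)
  | Or b c => Or (undia K b) (undia K c)
  | Dia _ _ => dia_letter K a
  | Box m b => Box m (undia K b)
  end.

Fixpoint dia_defs K a : seq (form tau (P + 'I_K.+1)) :=
  match a with
  | Top | Var _ => [::]
  | Neg b => dia_defs K b
  | Or b c => dia_defs K b ++ dia_defs K c
  | Dia m b =>
      let y := arg_letter K a in
      let z := dia_letter K a in
      map (Box m) (dia_defs K b) ++
      [:: Box m (Or (Neg y) (Neg (undia K b)));
          Box m (Or y (undia K b));
          Or (Neg z) (Neg (Box m y));
          Or z (Box m y)]
  | Box m b => map (Box m) (dia_defs K b)
  end.

Definition conjoin K (a : form tau (P + 'I_K.+1)) s :=
  foldr (@And tau _) a s.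

(** The largest letter index that can occur: subformulas have smaller numbers, and odd indices serve
    the arguments of diamonds. *)
Definition bound a := (form_number a).*2.+1.

Definition translation a : {k : nat & form tau (P + 'I_k)} :=
  existT _ (bound a).+1 (conjoin (undia (bound a) a) (dia_defs (bound a) a)).

(** The code of a subformula is a proper subtree, hence has a smaller number. So one [K], fixed at
    the root, serves the whole induction. *)
Lemma bound_sub K c :
  bound c <= K ->
  match c with
  | Top | Var _ => True
  | Neg b | Dia _ b | Box _ b => bound b <= K
  | Or b d => bound b <= K /\ bound d <= K
  end.
Proof.
have le_bound b d : form_number b < form_number d -> bound d <= K -> bound b <= K.
  by move=> lt_bd; apply: leq_trans; rewrite ltnS leq_double ltnW.
have lt2 x l r : tree_number r < tree_number (Node x (Node l r)).
  exact: ltn_trans (tree_number_ltr l r) (tree_number_ltr _ _).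
case: c => // [b|b d|m b|m b].
- by apply: le_bound; apply: tree_number_ltr.
- move=> le_cK; split; apply: le_bound le_cK; last exact: lt2.
  exact: ltn_trans (tree_number_ltl _ _) (tree_number_ltr _ _).
- by apply: le_bound; apply: lt2.
- by apply: le_bound; apply: lt2.
Qed.

Lemma form_number_inj : injective form_number.
Proof.
by move=> a b /tree_number_inj/(code_form_inj (@code_count_inj P)).
Qed.

Definition code_ext K := code_form (tau := tau) (@code_ext_letter P K.+1).

Lemma tmap_boxE K m s :
  tmap_box (code_count m) (code_list (map (@code_ext K) s)) =
  code_list (map (@code_ext K) (map (Box m) s)).
Proof. by elim: s => //= c s <-. Qed.

Lemma tconjE K e s :
  tconj (@code_ext K e) (code_list (map (@code_ext K) s)) =
  code_ext (conjoin e s).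
Proof.
elim: s => // c s ih.
exact: (congr1 (fun t => tneg (tor (tneg (code_ext c)) (tneg t))) ih).
Qed.

Lemma code_dia_letter K c :
  bound c <= K ->
  code_ext (dia_letter K c) = tletter (code_nat (form_number c).*2).
Proof. by move=> le_cK; rewrite /code_ext /= inordK // ltnS ltnW. Qed.

Lemma code_arg_letter K c :
  bound c <= K ->
  code_ext (arg_letter K c) = tletter (code_nat (form_number c).*2.+1).
Proof. by move=> le_cK; rewrite /code_ext /= inordK. Qed.

(** The program never sees [K]: the code of a new letter keeps only the value of its ordinal, which
    is the same for every [K] above the bound. *)
Lemma ttable_code K c :
  bound c <= K ->
  tfst (ttable (code c)) =
  Node (code_ext (undia K c)) (code_list (map (@code_ext K) (dia_defs K c))).
Proof.
elim: c => [|p|b ih|b ihb d ihd|m b ih|m b ih] le_cK; have := bound_sub le_cK.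
- by [].
- by [].
- by move=> /ih e; rewrite [LHS](ttable_neg (code b)) e.
- move=> [/ihb eb /ihd ed]; rewrite [LHS](ttable_or (code b) (code d)) eb ed.
  by rewrite [dia_defs _ _]/= map_cat -tappE.
- move=> /ih e; rewrite [LHS](ttable_dia (code_count m) (code b)) e; cbv zeta.
  rewrite (tnumberE (code (Dia m b))) tdoubleE -(code_dia_letter le_cK).
  rewrite -[Node Leaf _]/(code_nat (form_number (Dia m b)).*2.+1).
  rewrite -(code_arg_letter le_cK) [tsnd _]/= tmap_boxE.
  by rewrite [dia_defs _ _]/= map_cat -tappE.
- move=> /ih e; rewrite [LHS](ttable_box (code_count m) (code b)) e; cbv zeta.
  by rewrite [tsnd _]/= tmap_boxE.
Qed.

Lemma ttranslationE c : ttranslation (code c) = code_ext_form (translation c).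
Proof.
rewrite /ttranslation (ttable_code (leqnn _)) tconjE.
by rewrite tnumberE tdoubleE.
Qed.

(** * Semantic correctness of the translation *)

Section Semantics.
Variables (F : frame tau) (V : valuation P F).

Definition sat_all (Q : Type) (U : valuation Q F) w (s : seq (form tau Q)) :=
  foldr (fun e X => sat U w e /\ X) True s.

Lemma sat_all_cat (Q : Type) (U : valuation Q F) w (s t : seq (form tau Q)) :
  sat_all U w (s ++ t) <-> sat_all U w s /\ sat_all U w t.
Proof. by elim: s => /= [|c s ih]; tauto. Qed.

Lemma sat_all_box (Q : Type) (U : valuation Q F) w m (s : seq (form tau Q)) :
  sat_all U w (map (Box m) s) <-> forall v, acc m w v -> sat_all U v s.
Proof.
elim: s => /= [|c s ih]; first by [].
by rewrite ih; split=> [[h1 h2] v wv|h]; split; auto; move=> v /h[].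
Qed.

Lemma sat_conjoin K (U : valuation (P + 'I_K.+1) F) w e s :
  sat U w (conjoin e s) <-> sat U w e /\ sat_all U w s.
Proof. by elim: s => [|c s ih]; rewrite /= ?ih; tauto. Qed.

(** The definitions constrain the letters only at worlds reached through the boxes around them, and
    these are the worlds the induction visits: at a box or a diamond, the definitions of the
    argument hold at every successor. *)
Lemma sat_undia K (U : valuation (P + 'I_K.+1) F) c w :
  extension V U -> sat_all U w (dia_defs K c) ->
  sat U w (undia K c) <-> sat V w c.
Proof.
move=> ext; elim: c w => [|p|b ih|b ihb d ihd|m b ih|m b ih] w.
- by [].
- by move=> _; exact: ext.
- by move=> /ih /= ->.
- by move=> /sat_all_cat[/ihb hb /ihd hd]; rewrite /= hb hd.
- move=> /sat_all_cat[/sat_all_box hb [h1 [h2 [h3 [h4 _]]]]].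
  have hy v : acc m w v -> sat U v (arg_letter K (Dia m b)) <-> ~ sat V v b.
    move=> wv; have := h1 v wv; have := h2 v wv.
    by have := ih v (hb v wv); rewrite /=; tauto.
  have -> : sat U w (undia K (Dia m b)) <->
            ~ sat U w (Box m (arg_letter K (Dia m b))).
    by move: h3 h4; rewrite /=; tauto.
  split=> [h|[v [wv sb]] h]; last by have /hy := h v wv; apply.
  (* Classically, if no successor satisfies [b], then [y] holds at all of them, against the falsity
     of [Box m y]. *)
  apply: NNPP => nd; apply: h => v wv; apply/(hy v wv) => sb.
  by apply: nd; exists v.
- move=> /sat_all_box hb; split=> h v wv; apply/(ih v (hb v wv)); exact: h.
Qed.

(** Indices are decoded: an even one stands for the truth of a formula, an odd one for the failure
    of the argument of a diamond. Parity and injectivity of [form_number] make the decoding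
    unambiguous. *)
Definition intended K : valuation (P + 'I_K.+1) F := fun w x =>
  match x with
  | inl p => V w p
  | inr i =>
      (exists c, i = (form_number c).*2 :> nat /\ sat V w c) \/
      (exists m b, i = (form_number (Dia m b)).*2.+1 :> nat /\ ~ sat V w b)
  end.

Arguments intended : clear implicits.

Lemma sat_dia_letter K c w :
  bound c <= K -> sat (intended K) w (dia_letter K c) <-> sat V w c.
Proof.
move=> le_cK; rewrite /= inordK; last by rewrite ltnS (leq_trans _ le_cK).
split=> [[[d [e]]|[m [b [e]]]]|sc].
- by move: e => /double_inj/form_number_inj->.
- by have := congr1 odd e; rewrite /= !odd_double.
- by left; exists c.
Qed.

Lemma sat_arg_letter K m b w :
  bound (Dia m b) <= K ->
  sat (intended K) w (arg_letter K (Dia m b)) <-> ~ sat V w b.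
Proof.
move=> le_cK.
have val_i : @inord K (form_number (Dia m b)).*2.+1 = (form_number (Dia m b)).*2.+1 :> nat.
  exact: inordK.
split=> [[[d [e _]]|[n [d [e]]]]|sc].
- by have := congr1 odd e; rewrite val_i /= !odd_double.
- move: e; rewrite val_i => /succn_inj/double_inj/form_number_inj e.
  by case: e => _ ->.
- by right; exists m, b.
Qed.

(** By induction the definitions of [b] hold everywhere, so [sat_undia] identifies [undia K b] with
    [b]; the four clauses of the diamond then follow from the intended meaning of its two
    letters. *)
Lemma sat_dia_defs K c w : bound c <= K -> sat_all (intended K) w (dia_defs K c).
Proof.
have ext : extension V (intended K) by [].
elim: c w => [|p|b ih|b ihb d ihd|m b ih|m b ih] w le_cK; have := bound_sub le_cK.
- by [].
- by [].
- by move=> le_bK; exact: ih.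
- by move=> [le_bK le_dK]; apply/sat_all_cat; split; [exact: ihb | exact: ihd].
- move=> le_bK; apply/sat_all_cat; split; first by apply/sat_all_box => v _; exact: ih.
  have hu v : sat (intended K) v (undia K b) <-> sat V v b.
    by apply: sat_undia (ih v le_bK).
  have hy v := sat_arg_letter v le_cK.
  have hz : sat (intended K) w (dia_letter K (Dia m b)) <->
            ~ sat (intended K) w (Box m (arg_letter K (Dia m b))).
    rewrite sat_dia_letter //; split=> [[v [wv sb]] h|h].
      by have /hy := h v wv; apply.
    apply: NNPP => nd; apply: h => v wv; apply/hy => sb.
    by apply: nd; exists v.
  split; [|split; [|split; [|split]]] => //.
  + by move=> v _; move: (hu v) (hy v); rewrite /=; tauto.
  + by move=> v _; move: (hu v) (hy v) (classic (sat V v b)); rewrite /=; tauto.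
  + by move: hz; rewrite /=; tauto.
  + move: hz (classic (sat (intended K) w (Box m (arg_letter K (Dia m b))))).
    by rewrite /=; tauto.
- by move=> le_bK; apply/sat_all_box => v _; exact: ih.
Qed.

Lemma sat_translation c w :
  sat V w c <->
  exists U : valuation (P + 'I_(projT1 (translation c))) F,
    extension V U /\ sat U w (projT2 (translation c)).
Proof.
split=> [sc|[U [ext /sat_conjoin[su sd]]]]; last by apply/(sat_undia ext sd).
have sd := sat_dia_defs w (leqnn (bound c)).
exists (intended (bound c)); split; first by [].
by apply/sat_conjoin; split=> //; apply/sat_undia.
Qed.

End Semantics.

(** * The translation lands in the box fragment *)

Lemma pos_box_lit_undia K c : pos_lit c -> pos_box_lit (undia K c).
Proof. by elim: c. Qed.

(** Clausal form allows no conjunction below a box, whereas a single clause absorbs a further box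
    into its prefix; hence definitions are tracked as clauses. *)
Definition is_clause (Q : Type) (lit : pred (form tau Q)) (c : form tau Q) :=
  exists nabla negs poss,
    [/\ all lit negs, all lit poss, size negs + size poss <= 2
      & c = boxes nabla (disj (map (@Neg tau Q) negs ++ poss))].

Fixpoint all_clauses (Q : Type) lit (s : seq (form tau Q)) : Prop :=
  if s is c :: s' then is_clause lit c /\ all_clauses lit s' else True.

Lemma is_clause_box (Q : Type) lit m (c : form tau Q) :
  is_clause lit c -> is_clause lit (Box m c).
Proof.
by move=> [nabla [negs [poss [h1 h2 h3 ->]]]]; exists (m :: nabla), negs, poss.
Qed.

Lemma all_clauses_box (Q : Type) lit m (s : seq (form tau Q)) :
  all_clauses lit s -> all_clauses lit (map (Box m) s).
Proof. by elim: s => //= c s ih [/is_clause_box hc /ih]. Qed.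

Lemma all_clauses_cat (Q : Type) lit (s t : seq (form tau Q)) :
  all_clauses lit s -> all_clauses lit t -> all_clauses lit (s ++ t).
Proof. by elim: s => //= c s ih [hc /ih h] /h. Qed.

Let boxlit K := @pos_box_lit tau (P + 'I_K.+1).

(** Both [undia K b] and [Box m y] are box literals, so each definition is a binary clause; the
    outer box of the first two becomes the prefix. *)
Lemma dia_defs_lit K c : pos_lit c -> all_clauses (@boxlit K) (dia_defs K c).
Proof.
elim: c => //= m b ih lb; last exact/all_clauses_box/ih.
have lu := pos_box_lit_undia K lb.
apply: all_clauses_cat; first exact/all_clauses_box/ih.
set y := arg_letter _ _; set z := dia_letter _ _.
split; [|split; [|split; [|split]]] => //.
- by exists [:: m], [:: y; undia K b], [::]; rewrite /= /boxlit lu.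
- by exists [:: m], [::], [:: y; undia K b]; rewrite /= /boxlit lu.
- by exists [::], [:: z; Box m y], [::].
- by exists [::], [::], [:: z; Box m y].
Qed.

Lemma dia_defs_boxes K nabla c :
  all_clauses (@boxlit K) (dia_defs K c) ->
  all_clauses (@boxlit K) (dia_defs K (boxes nabla c)).
Proof. by move=> hc; elim: nabla => //= m s ih; exact: all_clauses_box. Qed.

(** Indices past the end read the default [Top], which has no definitions. *)
Lemma dia_defs_disj K s :
  (forall i, all_clauses (@boxlit K) (dia_defs K (nth Top s i))) ->
  all_clauses (@boxlit K) (dia_defs K (disj s)).
Proof.
elim: s => [|c [|d s] ih] // hs; first exact: (hs 0).
by apply: all_clauses_cat; [exact: (hs 0) | apply: ih => i; exact: (hs i.+1)].
Qed.

Lemma undia_boxes K nabla c : undia K (boxes nabla c) = boxes nabla (undia K c).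
Proof. by elim: nabla => //= m s ->. Qed.

Lemma undia_disj K s : undia K (disj s) = disj (map (undia K) s).
Proof. by elim: s => // c [|d s] //= ->. Qed.

Lemma krom_dia_defs K c :
  krom_over (@pos_lit tau P) c -> all_clauses (@boxlit K) (dia_defs K c).
Proof.
elim=> [l|l|nabla negs poss /(all_nthP Top) hn /(all_nthP Top) hp _|b d _ ihb _ ihd].
- exact: dia_defs_lit.
(* [dia_defs] passes through negation, so the literal case applies by conversion. *)
- exact: (@dia_defs_lit K l).
- apply/dia_defs_boxes/dia_defs_disj => i; rewrite nth_cat size_map.
  case: ltnP => [lt_in|_].
    by rewrite (nth_map Top) //; exact: (dia_defs_lit K (hn i lt_in)).
  have [lt_ip|le_pi] := ltnP (i - size negs) (size poss).
    exact/dia_defs_lit/hp.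
  by rewrite nth_default.
- exact: all_clauses_cat.
Qed.

Lemma krom_undia K c :
  krom_over (@pos_lit tau P) c -> krom_over (@boxlit K) (undia K c).
Proof.
have hall s : all (@pos_lit tau P) s -> all (@boxlit K) (map (undia K) s).
  by rewrite all_map; apply: sub_all => l; exact: pos_box_lit_undia.
elim=> [l hl|l hl|nabla negs poss hn hp hs|b d _ ihb _ ihd].
- exact/Krom_pos/pos_box_lit_undia.
- exact/Krom_neg/pos_box_lit_undia.
- rewrite undia_boxes undia_disj map_cat -map_comp.
  rewrite (map_comp (@Neg tau _) (undia K)).
  by apply: Krom_clause; rewrite ?size_map ?hall.
- exact: Krom_and.
Qed.

Lemma KromBox_translation c : Krom c -> KromBox (projT2 (translation c)).
Proof.
move=> hc /=; have := krom_dia_defs (bound c) hc.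
elim: dia_defs => [_|d s ih [hd /ih hs]]; first exact: krom_undia.
apply: Krom_and hs; move: hd => [nabla [negs [poss [h1 h2 h3 ->]]]].
exact: Krom_clause.
Qed.

End Translation.

Lemma KromBox_Krom tau P (a : form tau P) : KromBox a -> Krom a.
Proof.
have sub (l : form tau P) : pos_box_lit l -> pos_lit l by elim: l.
elim=> [l hl|l hl|nabla negs poss hn hp hs|b d _ ihb _ ihd].
- exact/Krom_pos/sub.
- exact/Krom_neg/sub.
- by apply: Krom_clause => //; [exact: sub_all hn | exact: sub_all hp].
- exact: Krom_and.
Qed.

Lemma strong_le_translation (tau : finType) (P : countType) (L L' : fragment tau) :
  (forall a : form tau P, L P a -> L' _ (projT2 (translation a))) ->
  strong_le P L L'.
Proof.
move=> hL; exists (@translation tau P); split; last first.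
  by move=> a /hL ha; split=> // F V w; exact: sat_translation.
have [p hp] := computable_ttranslation.
by exists p => a _; rewrite -ttranslationE; exact: hp.
Qed.

(** * Inexpressibility of [Dia m Top] *)

Definition point (tau : Type) (reflexive : Prop) : frame tau :=
  @Frame tau unit (inhabits tt) (fun _ _ _ => reflexive).

Definition all_true (tau P : Type) (F : frame tau) : valuation P F :=
  fun _ _ => True.

Section AllTrue.
Variables tau P : Type.
Let sat_pt X (a : form tau P) := sat (@all_true tau P (point tau X)) tt a.

Lemma sat_pos_box_lit X l : pos_box_lit l -> sat_pt X l.
Proof. by elim: l => //= m b ih /ih hb [] _. Qed.

(** Negated box literals fail when all letters are true, so a true clause has a positive literal,
    and that one also holds at the dead end. *)
Lemma sat_clause_dead X negs poss :
  all (@pos_box_lit tau P) negs -> all (@pos_box_lit tau P) poss ->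
  sat_pt X (disj (map (@Neg tau P) negs ++ poss)) ->
  sat_pt False (disj (map (@Neg tau P) negs ++ poss)).
Proof.
elim: negs => [_|l negs ih /= /andP[hl /ih{}ih] hp].
  case: poss => [|l [|l' poss]] //= /andP[hl _] _; first exact: sat_pos_box_lit.
  by left; exact: sat_pos_box_lit.
case: (_ ++ _) (ih hp) => [_|d s {}ih [|/ih]]; try by case; exact: sat_pos_box_lit.
by right.
Qed.

(** Clauses with a nonempty prefix hold vacuously at the dead end; the others are covered by
    [sat_clause_dead]. *)
Lemma KromBox_dead_end (a : form tau P) :
  KromBox a -> sat_pt True a -> sat_pt False a.
Proof.
elim=> [l hl _|l hl|nabla negs poss hn hp _|b d _ ihb _ ihd].
- exact: sat_pos_box_lit.
- by case; exact: sat_pos_box_lit.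
- case: nabla => [|m nabla _]; first exact: sat_clause_dead.
  by move=> v [].
- by rewrite /sat_pt /= => h [hb|hd]; apply: h; [left=> /ihb | right=> /ihd].
Qed.

End AllTrue.

Theorem theorem5 (tau : finType) (P : countType) :
  strong_equiv P (@KromBox tau) (@Krom tau) /\
  (0 < #|tau| -> weak_lt P (@KromBox tau) (@Krom tau)).
Proof.
split.
  split; apply: strong_le_translation => a ha; last exact: KromBox_translation.
  (* The easy inclusion reuses the same translation, which already has the enlarged alphabet as its
     target. *)
  exact/KromBox_Krom/KromBox_translation/KromBox_Krom.
case/card_gt0P=> m _; split.
  exists id; split; first by exists PId => a _; constructor.
  by move=> a /KromBox_Krom.
case=> _ [t [_ ht]]; have [|ht1 ht2] := ht (Dia m Top); first exact: Krom_pos.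
(* The translation of [Dia m Top] holds at the reflexive point, hence at the dead end, where
   [Dia m Top] would demand a successor. *)
have [_] := ht2 (point tau False) (@all_true tau P _) tt.
case; last by move=> v [].
apply: KromBox_dead_end => //; apply/(ht2 (point tau True)).
by exists tt.
Qed.
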